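(* For $\ell\in\mathbb{Z}$ and $m=0,1,2,\ldots$, with $m\ge\ell$, the following reduction formula holds true for $x\in\mathbb{R}$: $$\mathrm{M}_{\ell/2,\,m+(1-\ell)/2}(x)=(2m-\ell+1)\binom{2m-\ell}{m}(-1)^{m-\ell}x^{\ell/2-m}\left[e^{x/2}\,\mathcal{P}(-\ell,m-\ell,-x)-e^{-x/2}\,\mathcal{P}(\ell,m,x)\right],$$ where $\mathcal{P}$ denotes the polynomials $$\mathcal{P}(s,k,z)=\sum_{n=0}^{k}\binom{k}{n}(2k-s-n)!\,z^n.$$
   Context: The Whittaker function is $\mathrm{M}_{\kappa,\mu}(x)=x^{\mu+1/2}e^{-x/2}\,{}_1F_1\!\left(\tfrac12+\mu-\kappa;\,1+2\mu;\,x\right)$, $2\mu\neq-1,-2,\ldots$, where ${}_1F_1$ is the Kummer confluent hypergeometric function. *)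

(* Defs.v *)
(* Stdlib real numbers, with Coquelicot's complex numbers. *)
From Stdlib Require Export Reals ZArith.
From Coquelicot Require Export Coquelicot.

(* Coquelicot's [C] is the type of complex numbers; the real-valued binomial
   coefficient of Stdlib is [Binomial.C].  It is a ratio of factorials, so it is
   the binomial coefficient only when the lower index is at most the upper one. *)
Definition binom (n k : nat) : R := Binomial.C n k.

Local Open Scope C_scope.

Definition Cexp (z : C) : C :=
  ((exp (Re z) * cos (Im z))%R, (exp (Re z) * sin (Im z))%R).

(* Values in (-PI, PI]; in particular Arg x = PI for real x < 0. *)
Definition Arg (z : C) : R :=
  if Rle_dec 0 (Im z) then acos (Re z / Cmod z) else (- acos (Re z / Cmod z))%R.

Definition Clog (z : C) : C := (ln (Cmod z), Arg z).

(* Principal branch of z^a.  Convention at the origin: 0^0 = 1, and 0^a = 0 for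
   every other a, including the exponents for which 0^a has no value. *)
Definition Cpower (z a : C) : C :=
  if Ceq_dec z 0 then (if Ceq_dec a 0 then 1 else 0) else Cexp (a * Clog z).

(* Sum of a convergent complex series, taken componentwise as in [C_RInt]. *)
Definition CSeries (a : nat -> C) : C :=
  (Series (fun n => Re (a n)), Series (fun n => Im (a n))).

Fixpoint pochhammer (a : C) (n : nat) : C :=
  match n with
  | O => 1
  | S p => pochhammer a p * (a + INR p)
  end.

(* Meaningful unless b is one of 0, -1, -2, ... *)
Definition hyp1F1 (a b z : C) : C :=
  CSeries (fun n => pochhammer a n / pochhammer b n * (z ^ n / INR (fact n))).

Definition WhittakerM (kappa mu z : C) : C :=
  Cpower z (mu + 1 / 2) * Cexp (- z / 2) *
  hyp1F1 (1 / 2 + mu - kappa) (1 + 2 * mu) z.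

(* The argument of the factorial is an integer, truncated at 0 by [Z.to_nat];
   the truncation is inactive as soon as s <= k. *)
Definition calP (s : Z) (k : nat) (z : C) : C :=
  sum_n (fun n : nat =>
    RtoC (binom k n) *
    RtoC (INR (fact (Z.to_nat (2 * Z.of_nat k - s - Z.of_nat n)))) * z ^ n) k.

(* Main.v *)
(* With [a = m - l], Euler's integral reduces the claim to the evaluation of
   [J a m = x ^ (a + m + 1) * RInt (fun t => t ^ a * (1 - t) ^ m * exp (x * t)) 0 1],
   for which repeated integration by parts gives
   [(-1) ^ a * (exp x * P(-l, a, -x) - P(l, m, x))].  Instead of integrating, we
   take this closed form and the power series of [J a m] and check that both
   satisfy [J a (m+1) = x * J a m - J (a+1) m] (from t^a (1-t) = t^a - t^(a+1);
   for the closed form this is Pascal's rule) and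
   [J (a+1) 0 = x ^ (a+1) * exp x - (a+1) * J a 0]. *)

Require Import Defs.
From Stdlib Require Import Lra Lia.

Local Open Scope R_scope.

(** * Recursions for the closed form *)

Lemma pascal_sum (f : nat -> R) (m : nat) :
  sum_f_R0 (fun n => Binomial.C (S m) n * f n) (S m) =
  sum_f_R0 (fun n => Binomial.C m n * f n) m +
  sum_f_R0 (fun n => Binomial.C m n * f (S n)) m.
Proof.
  assert (Cn0 : forall n, Binomial.C n 0 = 1).
  { intros n. unfold Binomial.C. rewrite Nat.sub_0_r. simpl fact. simpl INR.
    field. apply INR_fact_neq_0. }
  assert (Cnn : forall n, Binomial.C n n = 1).
  { intros n. unfold Binomial.C. rewrite Nat.sub_diag. simpl fact. simpl INR.
    field. apply INR_fact_neq_0. }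
  destruct m as [|m].
  { simpl. rewrite !Cn0, Cnn. ring. }
  rewrite decomp_sum by lia. simpl Init.Nat.pred. rewrite tech5.
  rewrite (decomp_sum (fun n => Binomial.C (S m) n * f n)) by lia.
  simpl Init.Nat.pred.
  rewrite (tech5 (fun n => Binomial.C (S m) n * f (S n))).
  rewrite (sum_eq (fun i => Binomial.C (S (S m)) (S i) * f (S i))
    (fun i => Binomial.C (S m) (S i) * f (S i) + Binomial.C (S m) i * f (S i))).
  2: { intros i Hi. rewrite <- pascal by lia. ring. }
  rewrite sum_plus, !Cn0, !Cnn. ring.
Qed.

(* [calP s k] with [a = k - s]. *)
Definition fact_poly (a k : nat) (x : R) : R :=
  sum_f_R0 (fun n => Binomial.C k n * (INR (fact (a + k - n)) * x ^ n)) k.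

(** Pascal's rule leaves one sum with factorials (a+k+1-n)! and one in which n and k rise together,
    so that the factorial stays (a+k-n)! and a factor x comes out. *)
Lemma fact_poly_succ (a k : nat) (x : R) :
  fact_poly a (S k) x = fact_poly (S a) k x + x * fact_poly a k x.
Proof.
  unfold fact_poly. rewrite pascal_sum, scal_sum. f_equal; apply sum_eq; intros n Hn.
  - do 4 f_equal. lia.
  - replace (a + S k - S n)%nat with (a + k - n)%nat by lia. simpl. ring.
Qed.

(** Since C(k,n) (k-n)! = k!/n!, the polynomial with a = 0 is k! times the exponential series cut
    after x^k. *)
Lemma fact_poly_0_l_succ (k : nat) (x : R) :
  fact_poly 0 (S k) x = INR (S k) * fact_poly 0 k x + x ^ S k.
Proof.
  assert (H : forall j n, (n <= j)%nat ->
    Binomial.C j n * INR (fact (0 + j - n)) = INR (fact j) / INR (fact n)).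
  { intros j n Hn. unfold Binomial.C. rewrite Nat.add_0_l.
    field. split; apply INR_fact_neq_0. }
  unfold fact_poly. rewrite tech5, scal_sum. f_equal.
  - apply sum_eq. intros n Hn. rewrite <- !Rmult_assoc, !H by lia.
    rewrite fact_simpl, mult_INR. field. apply INR_fact_neq_0.
  - rewrite <- Rmult_assoc, H by lia. field. apply INR_fact_neq_0.
Qed.

Lemma fact_poly_0_r (a : nat) (x : R) : fact_poly a 0 x = INR (fact a).
Proof.
  unfold fact_poly, Binomial.C. simpl. replace (a + 0 - 0)%nat with a by lia. field.
Qed.

(* The value of [J a m] in the header. *)
Definition beta_exp (a m : nat) (x : R) : R :=
  (- 1) ^ a * (exp x * fact_poly m a (- x) - fact_poly a m x).

(** Both [fact_poly a (S m) x] and [fact_poly m (S a) (- x)] split; the two terms in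
    [exp x * fact_poly m a (- x)] cancel. *)
Lemma beta_exp_succ_r (a m : nat) (x : R) :
  beta_exp a (S m) x = x * beta_exp a m x - beta_exp (S a) m x.
Proof.
  unfold beta_exp. rewrite !fact_poly_succ. simpl. ring.
Qed.

Lemma beta_exp_succ_l_0 (a : nat) (x : R) :
  beta_exp (S a) 0 x = x ^ S a * exp x - INR (S a) * beta_exp a 0 x.
Proof.
  unfold beta_exp. rewrite fact_poly_0_l_succ, !fact_poly_0_r.
  rewrite fact_simpl, mult_INR.
  replace (- x) with (-1 * x) at 2 by ring. rewrite Rpow_mult_distr.
  (* The sign of (-x)^(a+1) meets the prefactor (-1)^(a+1). *)
  assert (H : (-1) ^ S a * (-1) ^ S a = 1).
  { rewrite <- Rpow_mult_distr. replace (-1 * -1) with 1 by ring. apply pow1. }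
  replace ((-1) ^ a) with (- (-1) ^ S a) by (simpl; ring).
  ring [H].
Qed.

(** * Power series of the closed form *)

Lemma is_series_R_ext (a b : nat -> R) (l l' : R) :
  (forall n, a n = b n) -> l = l' -> is_series a l -> is_series b l'.
Proof.
  intros H <-. apply is_series_ext. exact H.
Qed.

Lemma is_series_R_scal (c : R) (a : nat -> R) (l : R) :
  is_series a l -> is_series (fun n => c * a n) (c * l).
Proof.
  exact (is_series_scal_l (K := R_AbsRing) (V := R_NormedModule) c a l).
Qed.

Lemma is_series_R_minus (a b : nat -> R) (la lb : R) :
  is_series a la -> is_series b lb -> is_series (fun n => a n - b n) (la - lb).
Proof.
  exact (is_series_minus (K := R_AbsRing) (V := R_NormedModule) a b la lb).
Qed.

Lemma is_series_R_tail (a : nat -> R) (l : R) :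
  is_series a l -> is_series (fun n => a (S n)) (l - a 0%nat).
Proof.
  intros H. apply is_series_incr_1. revert H. apply is_series_R_ext; [reflexivity |].
  unfold plus; simpl. ring.
Qed.

Lemma is_series_exp (x : R) : is_series (fun n => x ^ n / INR (fact n)) (exp x).
Proof.
  apply is_series_R_ext with (3 := proj1 (is_pseries_R _ _ _) (is_exp_Reals x)).
  - intros n. unfold Rdiv. apply Rmult_comm.
  - reflexivity.
Qed.

(** Expanding exp (x t) inside J gives as n-th coefficient the beta integral of t^(a+n) (1-t)^m
    divided by n!. The induction on [m] keeps [a] general because its recursion also calls on
    a+1. *)
Lemma is_series_beta_exp (a m : nat) (x : R) :
  is_series (fun n => x ^ (a + m + 1 + n) *
    (INR (fact m) * INR (fact (a + n)) / (INR (fact (a + m + 1 + n)) * INR (fact n))))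
    (beta_exp a m x).
Proof.
  revert a. induction m as [|m IHm]; intros a.
  - induction a as [|a IHa].
    + eapply is_series_R_ext; [| | exact (is_series_R_tail _ _ (is_series_exp x))].
      * intros n. cbv beta. replace (0 + 0 + 1 + n)%nat with (S n) by lia.
        rewrite Nat.add_0_l. simpl (fact 0). simpl (INR 1).
        field. split; apply INR_fact_neq_0.
      * unfold beta_exp. rewrite !fact_poly_0_r. simpl. field.
    (* The term of index 0 in the difference is x^(a+1) - (a+1) x^(a+1) a!/(a+1)! = 0; dropping it
       aligns the powers of x. *)
    + eapply is_series_R_ext; [| | exact (is_series_R_tail _ _ (is_series_R_minus _ _ _ _
        (is_series_R_scal (x ^ S a) _ _ (is_series_exp x))
        (is_series_R_scal (INR (S a)) _ _ IHa)))].
      * intros n. cbv beta.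
        replace (a + 0 + 1 + S n)%nat with (S (S (a + n))) by lia.
        replace (S a + 0 + 1 + n)%nat with (S (S (a + n))) by lia.
        replace (a + S n)%nat with (S (a + n)) by lia.
        replace (S a + n)%nat with (S (a + n)) by lia.
        rewrite !fact_simpl, !mult_INR, !S_INR, plus_INR, <- !tech_pow_Rmult, pow_add.
        simpl (fact 0). simpl (INR 1).
        assert (P := pos_INR a). assert (Q := pos_INR n).
        field. repeat split; try apply INR_fact_neq_0; lra.
      * rewrite beta_exp_succ_l_0.
        replace (a + 0 + 1 + 0)%nat with (S a) by lia.
        replace (a + 0)%nat with a by lia.
        rewrite fact_simpl, mult_INR. simpl (fact 0). simpl (INR 1).
        rewrite pow_O. field. split; [apply INR_fact_neq_0 | apply not_0_INR; lia].
  - eapply is_series_R_ext; [| | exact (is_series_R_minus _ _ _ _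
      (is_series_R_scal x _ _ (IHm a)) (IHm (S a)))].
    (* Here the powers agree without a shift, and the coefficients reduce to (a+m+n+2) - (a+n+1) =
       m+1. *)
    + intros n. cbv beta.
      replace (a + S m + 1 + n)%nat with (S (a + m + 1 + n)) by lia.
      replace (S a + m + 1 + n)%nat with (S (a + m + 1 + n)) by lia.
      replace (S a + n)%nat with (S (a + n)) by lia.
      rewrite <- !tech_pow_Rmult.
      rewrite !fact_simpl, !mult_INR, !S_INR, !plus_INR.
      assert (P := pos_INR a). assert (Q := pos_INR n). assert (T := pos_INR m).
      simpl (INR 1). field. repeat split; try apply INR_fact_neq_0; lra.
    + symmetry. apply beta_exp_succ_r.
Qed.

Local Open Scope C_scope.

(** * Complex exponential and principal powers *)

Lemma Cexp_RtoC (r : R) : Cexp r = exp r.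
Proof.
  unfold Cexp. simpl Re. simpl Im. rewrite cos_0, sin_0, Rmult_1_r, Rmult_0_r.
  reflexivity.
Qed.

Lemma Cexp_plus (a b : C) : Cexp (a + b) = Cexp a * Cexp b.
Proof.
  destruct a as [a1 a2], b as [b1 b2]. unfold Cexp, Cplus, Cmult. simpl.
  rewrite exp_plus, cos_plus, sin_plus. f_equal; ring.
Qed.

(** The sine of an arccosine is nonnegative and yields |Im z| / |z|; the case split in [Arg]
    restores the sign of Im z. *)
Lemma Cexp_Clog (z : C) : z <> 0 -> Cexp (Clog z) = z.
Proof.
  intros Hz. assert (Hp : (0 < Cmod z)%R) by (apply Cmod_gt_0; exact Hz).
  assert (Hn : (Cmod z * Cmod z = Re z * Re z + Im z * Im z)%R).
  { unfold Cmod. rewrite sqrt_sqrt by nra. unfold Re, Im. ring. }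
  assert (Ht : (-1 <= Re z / Cmod z <= 1)%R).
  { split; [apply Rle_div_r | apply Rle_div_l]; nra. }
  assert (Hs : sqrt (1 - (Re z / Cmod z)²) = (Rabs (Im z) / Cmod z)%R).
  { rewrite <- (sqrt_Rsqr (Rabs (Im z) / Cmod z)).
    - f_equal. rewrite !Rsqr_div', <- Rsqr_abs.
      replace (Im z)² with ((Cmod z)² - (Re z)²)%R by (unfold Rsqr; lra).
      unfold Rsqr. field. lra.
    - apply Rdiv_le_0_compat; [apply Rabs_pos | exact Hp]. }
  change (Cexp (Clog z)) with
    ((exp (ln (Cmod z)) * cos (Arg z))%R, (exp (ln (Cmod z)) * sin (Arg z))%R).
  rewrite exp_ln by exact Hp. unfold Arg.
  destruct (Rle_dec 0 (Im z)) as [Hi|Hi].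
  - rewrite cos_acos, sin_acos, Hs by exact Ht.
    rewrite Rabs_pos_eq by exact Hi. destruct z as [u v]. unfold Re, Im in *.
    simpl in *. f_equal; field; lra.
  - rewrite cos_neg, sin_neg, cos_acos, sin_acos, Hs by exact Ht.
    rewrite Rabs_left by lra. destruct z as [u v]. unfold Re, Im in *.
    simpl in *. f_equal; field; lra.
Qed.

(** Integer shifts of the exponent are safe even on the branch cut, which is what lets negative x be
    treated together with positive x. *)
Lemma Cpower_plus_INR (z a : C) (n : nat) :
  z <> 0 -> Cpower z (a + INR n) = Cpower z a * z ^ n.
Proof.
  intros Hz. unfold Cpower. destruct (Ceq_dec z 0) as [E|_]; [contradiction |].
  rewrite Cmult_plus_distr_r, Cexp_plus. f_equal.
  induction n as [|n IHn].
  - simpl. rewrite Cmult_0_l, Cexp_RtoC, exp_0. reflexivity.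
  - rewrite S_INR, RtoC_plus, Cmult_plus_distr_r, Cexp_plus, IHn, Cmult_1_l,
      Cexp_Clog by exact Hz.
    simpl. ring.
Qed.

Lemma Cpower_0_l (r : R) : r <> 0%R -> Cpower 0 r = 0.
Proof.
  intros Hr. unfold Cpower. destruct (Ceq_dec 0 0) as [_|E]; [| congruence].
  destruct (Ceq_dec r 0) as [E|_]; [| reflexivity].
  apply RtoC_inj in E. contradiction.
Qed.

(** * Reduction of the complex notions to real ones *)

Lemma sum_n_RtoC (f : nat -> R) (k : nat) :
  sum_n (fun n => RtoC (f n)) k = RtoC (sum_f_R0 f k).
Proof.
  induction k as [|k IHk].
  - apply sum_O.
  - rewrite sum_Sn, IHk. symmetry. apply RtoC_plus.
Qed.

Lemma calP_RtoC (a k : nat) (x : R) :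
  calP (Z.of_nat k - Z.of_nat a) k x = fact_poly a k x.
Proof.
  unfold calP, fact_poly. rewrite <- sum_n_RtoC. apply sum_n_ext. intros n.
  rewrite !RtoC_mult, RtoC_pow, Cmult_assoc. unfold binom. do 5 f_equal. lia.
Qed.

Lemma CSeries_RtoC (a : nat -> C) (f : nat -> R) (s : R) :
  (forall n, a n = f n) -> is_series f s -> CSeries a = s.
Proof.
  intros H Hs. unfold CSeries, RtoC. f_equal; apply is_series_unique.
  - revert Hs. apply is_series_R_ext; [| reflexivity]. intros n. now rewrite H.
  - apply is_series_R_ext with (fun n => (0 * f n)%R) (0 * s)%R.
    + intros n. rewrite H. simpl. ring.
    + ring.
    + apply is_series_R_scal, Hs.
Qed.

Lemma pochhammer_INR (j n : nat) :
  pochhammer (INR (S j)) n = (INR (fact (j + n)) / INR (fact j))%R.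
Proof.
  induction n as [|n IHn].
  - simpl. rewrite Nat.add_0_r. f_equal. field. apply INR_fact_neq_0.
  - change (pochhammer (INR (S j)) (S n)) with
      (pochhammer (INR (S j)) n * (INR (S j) + INR n)).
    rewrite IHn, <- RtoC_plus, <- RtoC_mult. f_equal.
    rewrite Nat.add_succ_r, fact_simpl, mult_INR, <- plus_INR.
    replace (S j + n)%nat with (S (j + n)) by lia.
    field. apply INR_fact_neq_0.
Qed.

(** Every exponent a+m+1+n in the series is positive, so at 0 it is the zero series, obtained here
    as 0 times the exponential series. *)
Lemma beta_exp_0 (a m : nat) : beta_exp a m 0 = 0%R.
Proof.
  rewrite <- (is_series_unique _ _ (is_series_beta_exp a m 0)).
  apply is_series_unique.
  apply is_series_R_ext with (3 := is_series_R_scal 0 _ _ (is_series_exp 0)).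
  - intros n. rewrite (pow_i (a + m + 1 + n)) by lia. ring.
  - ring.
Qed.

(** Euler's integral at the level of coefficients: (a+1)_n / (a+m+2)_n = (a+n)! (a+m+1)! / (a!
    (a+m+1+n)!). *)
Lemma hyp1F1_beta_exp (a m : nat) (x : R) : x <> 0%R ->
  hyp1F1 (INR (S a)) (INR (S (a + m + 1))) x =
  (INR (fact (a + m + 1)) / (INR (fact a) * INR (fact m) * x ^ (a + m + 1))
   * beta_exp a m x)%R.
Proof.
  intros Hx. eapply CSeries_RtoC.
  2: { apply is_series_R_scal, is_series_beta_exp. }
  intros n. cbv beta.
  rewrite !pochhammer_INR, <- RtoC_pow, <- !RtoC_div, <- RtoC_mult.
  - f_equal. rewrite (pow_add x (a + m + 1) n). field.
    repeat split; solve [apply INR_fact_neq_0 | apply pow_nonzero; exact Hx].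
  - apply INR_fact_neq_0.
  - apply Rmult_integral_contrapositive_currified; [| apply Rinv_neq_0_compat];
      apply INR_fact_neq_0.
Qed.

Lemma binom_add (a m : nat) :
  binom (m + a) m = (INR (fact (m + a)) / (INR (fact m) * INR (fact a)))%R.
Proof.
  unfold binom, Binomial.C. replace (m + a - m)%nat with a by lia. reflexivity.
Qed.

Theorem theorem16 (l : Z) (m : nat) (hlm : (l <= Z.of_nat m)%Z) (x : R) :
  WhittakerM (IZR l / 2) (INR m + (1 - IZR l) / 2) x =
  IZR (2 * Z.of_nat m - l + 1) *
  binom (Z.to_nat (2 * Z.of_nat m - l)) m *
  (- (1)) ^ Z.to_nat (Z.of_nat m - l) *
  Cpower x (IZR l / 2 - INR m) *
  (Cexp (x / 2) * calP (- l) (Z.to_nat (Z.of_nat m - l)) (- x)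
   - Cexp (- x / 2) * calP l m x).
Proof.
  (* With l = m - a all parameters become expressions in the naturals a and m. *)
  set (a := Z.to_nat (Z.of_nat m - l)).
  assert (El : l = (Z.of_nat m - Z.of_nat a)%Z) by lia.
  clearbody a. subst l. clear hlm.
  replace (- (Z.of_nat m - Z.of_nat a))%Z with (Z.of_nat a - Z.of_nat m)%Z by ring.
  replace (Z.to_nat (2 * Z.of_nat m - (Z.of_nat m - Z.of_nat a))) with (m + a)%nat by lia.
  replace (2 * Z.of_nat m - (Z.of_nat m - Z.of_nat a) + 1)%Z
    with (Z.of_nat (a + m + 1)) by lia.
  unfold WhittakerM. rewrite <- !RtoC_opp, !calP_RtoC, minus_IZR, <- !INR_IZR_INZ, RtoC_minus.
  (* The exponent of x on the left exceeds the one on the right by the integer a+m+1. *)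
  replace (INR m + (1 - (INR m - INR a)) / 2 + 1 / 2)
    with ((INR m - INR a) / 2 - INR m + INR (a + m + 1)) by
    (rewrite !plus_INR, !RtoC_plus; simpl (INR 1); field).
  replace (1 / 2 + (INR m + (1 - (INR m - INR a)) / 2) - (INR m - INR a) / 2)
    with (RtoC (INR (S a))) by (rewrite S_INR, RtoC_plus; field).
  replace (1 + 2 * (INR m + (1 - (INR m - INR a)) / 2))
    with (RtoC (INR (S (a + m + 1)))) by
    (rewrite S_INR, !plus_INR, !RtoC_plus; simpl (INR 1); field).
  replace (- (1))%R with (-1)%R by ring.
  replace (x / 2) with (RtoC (x / 2)) by (apply RtoC_div; lra).
  replace ((- x)%R / 2) with (RtoC (- x / 2)) by (apply RtoC_div; lra).
  (* Factoring out exp (-x/2) turns the symmetric bracket into [beta_exp]. *)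
  assert (E : (-1) ^ a * (exp (x / 2) * fact_poly m a (- x) - exp (- x / 2) * fact_poly a m x)
    = (exp (- x / 2) * beta_exp a m x)%R).
  { rewrite <- RtoC_pow, <- !RtoC_mult, <- RtoC_minus, <- RtoC_mult. f_equal.
    unfold beta_exp. replace (exp x) with (exp (x / 2) * exp (x / 2))%R by
      (rewrite <- exp_plus; f_equal; field).
    replace (- x / 2)%R with (- (x / 2))%R by field. rewrite exp_Ropp. field.
    apply Rgt_not_eq, exp_pos. }
  rewrite !Cexp_RtoC.
  transitivity (INR (a + m + 1) * binom (m + a) m * Cpower x ((INR m - INR a) / 2 - INR m) *
    (exp (- x / 2) * beta_exp a m x)%R).
  2: { rewrite <- E. ring. }
  destruct (Req_dec x 0) as [-> | Hx].
  (* At x = 0 the right side vanishes through [beta_exp], even if the exponent -(a+m)/2 is 0 and the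
     power is 1; the left side vanishes because its exponent (a+m)/2 + 1 is positive. *)
  - rewrite beta_exp_0, Rmult_0_r, Cmult_0_r.
    replace ((INR m - INR a) / 2 - INR m + INR (a + m + 1))
      with (RtoC (INR (a + m) / 2 + 1)) by
      (rewrite RtoC_plus, RtoC_div by lra; rewrite !plus_INR, !RtoC_plus;
       simpl (INR 1); field).
    rewrite Cpower_0_l; [ring |]. assert (P := pos_INR (a + m)). lra.
  - rewrite Cpower_plus_INR by (intros H; apply RtoC_inj in H; contradiction).
    rewrite hyp1F1_beta_exp by exact Hx. rewrite binom_add, <- RtoC_pow.
    set (p := Cpower _ _).
    transitivity (p * (x ^ (a + m + 1) * exp (- x / 2) *
      (INR (fact (a + m + 1)) / (INR (fact a) * INR (fact m) * x ^ (a + m + 1)) *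
       beta_exp a m x))%R).
    { rewrite !RtoC_mult. ring. }
    rewrite <- RtoC_mult, (Cmult_comm (RtoC _) p), <- Cmult_assoc, <- RtoC_mult.
    (* The powers of x cancel, leaving (a+m+1)! / (a! m!) = (a+m+1) C(m+a,m). *)
    do 2 f_equal. replace (a + m + 1)%nat with (S (m + a)) by lia.
    rewrite fact_simpl, mult_INR. field.
    repeat split; solve [apply INR_fact_neq_0 | apply pow_nonzero; exact Hx].
Qed.
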